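(* Let $S$ be a $\Gamma$-hemiring with unities (a left unity and a right unity) and let $R$ be its right operator hemiring. Then there exists an inclusion preserving bijection $\mu\times\sigma\longmapsto\mu^{*'}\times\sigma^{*'}$ between the set of all cartesian products of fuzzy $h$-ideals (respectively, prime fuzzy $h$-ideals, semiprime fuzzy $h$-ideals) of $S$ and the set of all cartesian products of fuzzy $h$-ideals (respectively, prime fuzzy $h$-ideals, semiprime fuzzy $h$-ideals) of $R$, where $\mu$ and $\sigma$ are fuzzy $h$-ideals (respectively, prime fuzzy $h$-ideals, semiprime fuzzy $h$-ideals) of $S$.
   Context: **$\Gamma$-hemiring.** Let $S,\Gamma$ be additive commutative semigroups with zero. $S$ is a $\Gamma$-hemiring if there is a map $S\times\Gamma\times S\to S$, $(a,\alpha,b)\mapsto a\alpha b$, such that for all $a,b,c\in S$, $\alpha,\beta\in\Gamma$: $(a+b)\alpha c=a\alpha c+b\alpha c$; $a\alpha(b+c)=a\alpha b+a\alpha c$; $a(\alpha+\beta)b=a\alpha b+a\beta b$; $a\alpha(b\beta c)=(a\alpha b)\beta c$; $0_S\alpha a=0_S=a\alpha 0_S$; $a0_\Gamma b=0_S=b0_\Gamma a$. **Hemiring.** A set $H$ with operations $+,\cdot$ such that $(H,+)$ is a commutative monoid with identity $0$, $(H,\cdot)$ is a semigroup, multiplication distributes over addition from either side, and $0s=0=s0$ for all $s$. **Right operator hemiring $R$.** Let $F$ be the free additive commutative semigroup generated by $\Gamma\times S$; define the congruence $\rho$ on $F$ by $\sum_{i=1}^m(\alpha_i,x_i)\,\rho\,\sum_{j=1}^n(\beta_j,y_j)$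 iff $\sum_i a\alpha_ix_i=\sum_j a\beta_jy_j$ for all $a\in S$. The class of $\sum_i(\alpha_i,x_i)$ is written $\sum_i[\alpha_i,x_i]$. $R=F/\rho$ with multiplication $(\sum_i[\alpha_i,x_i])(\sum_j[\beta_j,y_j])=\sum_{i,j}[\alpha_i,x_i\beta_jy_j]$ is a hemiring; its zero is $[\gamma,0_S]$ (any $\gamma\in\Gamma$). **Unities.** $S$ has a left unity if there are finitely many $e_i\in S,\delta_i\in\Gamma$ with $\sum_i e_i\delta_i a=a$ for all $a\in S$; it has a right unity if there are finitely many $\gamma_j\in\Gamma,f_j\in S$ with $\sum_j a\gamma_jf_j=a$ for all $a\in S$. **Fuzzy $h$-ideals.** A fuzzy subset of a set $X$ is a function $X\to[0,1]$; it is non-empty if it is not identically $0$. A non-empty fuzzy subset $\mu$ of $S$ is a fuzzy left (right) ideal if $\mu(x+y)\ge\min\{\mu(x),\mu(y)\}$ and $\mu(x\gamma y)\ge\mu(y)$ (resp. $\mu(x\gamma y)\ge\mu(x)$) for all $x,y\in S$, $\gamma\in\Gamma$. It is a fuzzy left (right) $h$-ideal if moreover for all $a,b,x,z\in S$, $x+a+z=b+z$ implies $\mu(x)\ge\min\{\mu(a),\mu(b)\}$. A fuzzy $h$-ideal is one which is both a fuzzy left and a fuzzy right $h$-ideal. The same definitions are used for a hemiring with $xy$ in place of $x\gamma y$. Convention: all fuzzy (left, right) $h$-ideals $\mu$ are assumed to satisfy $\mu(0)=1$. Inclusion: $\mu\subseteq\nu$ iff $\mu(x)\le\nu(x)$ for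 all $x$. **Simple $h$-product, prime, semiprime.** For fuzzy subsets $\mu,\theta$ of $S$, $(\mu\Gamma_h\theta)(x)=\sup\min\{\mu(a),\mu(c),\theta(b),\theta(d)\}$, the supremum over all $a,b,c,d,z\in S$, $\gamma,\delta\in\Gamma$ with $x+a\gamma b+z=c\delta d+z$, and $(\mu\Gamma_h\theta)(x)=0$ if there is no such expression. In a hemiring the same formula is used with $x+ab+z=cd+z$. A fuzzy $h$-ideal $\zeta$ is prime if it is non-constant and for any two fuzzy $h$-ideals $\mu,\nu$, $\mu\Gamma_h\nu\subseteq\zeta$ implies $\mu\subseteq\zeta$ or $\nu\subseteq\zeta$. It is semiprime if it is non-constant and for any fuzzy $h$-ideal $\mu$, $\mu\Gamma_h\mu\subseteq\zeta$ implies $\mu\subseteq\zeta$. **Cartesian products and the map.** For fuzzy subsets $\mu,\sigma$ of a set $X$, $\mu\times\sigma$ is the fuzzy subset of $X\times X$ with $(\mu\times\sigma)(x,y)=\min\{\mu(x),\sigma(y)\}$. For a fuzzy subset $\sigma$ of $S$, $\sigma^{*'}$ is the fuzzy subset of $R$ given by $\sigma^{*'}(\sum_i[\alpha_i,x_i])=\inf_{s\in S}\sigma(\sum_i s\alpha_ix_i)$. *)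

(* Defs.v *)
From HB Require Import structures.
From mathcomp Require Import all_boot all_order all_algebra.
From mathcomp Require Import finmap multiset.
From mathcomp Require Import boolp classical_sets functions reals.

Set Implicit Arguments.
Unset Strict Implicit.
Unset Printing Implicit Defensive.

Import Order.TTheory GRing.Theory Num.Theory.

Local Open Scope quotient_scope.
Local Open Scope classical_set_scope.
Local Open Scope ring_scope.

(* S and G are commutative semigroups with zero, i.e. [nmodType]s. *)
Record gammaHemiring (S G : nmodType) := GammaHemiring {
  gmul :> S -> G -> S -> S;
  gmulDl : forall a b x c, gmul (a + b) x c = gmul a x c + gmul b x c;
  gmulDr : forall a x b c, gmul a x (b + c) = gmul a x b + gmul a x c;
  gmulDm : forall a x y b, gmul a (x + y) b = gmul a x b + gmul a y b;
  gmulA : forall a x b y c, gmul a x (gmul b y c) = gmul (gmul a x b) y c;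
  gmul0l : forall x a, gmul 0 x a = 0;
  gmul0r : forall a x, gmul a x 0 = 0;
  gmul0m : forall a b, gmul a 0 b = 0
}.

Record hemiring (H : nmodType) := Hemiring {
  hmul :> H -> H -> H;
  hmulA : forall a b c, hmul a (hmul b c) = hmul (hmul a b) c;
  hmulDl : forall a b c, hmul (a + b) c = hmul a c + hmul b c;
  hmulDr : forall a b c, hmul a (b + c) = hmul a b + hmul a c;
  hmul0l : forall a, hmul 0 a = 0;
  hmul0r : forall a, hmul a 0 = 0
}.

Definition has_left_unity (S G : nmodType) (M : gammaHemiring S G) : Prop :=
  exists ed : seq (S * G), forall a : S, \sum_(p <- ed) M p.1 p.2 a = a.

Definition has_right_unity (S G : nmodType) (M : gammaHemiring S G) : Prop :=
  exists gf : seq (G * S), forall a : S, \sum_(p <- gf) M a p.1 p.2 = a.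

(* The free commutative semigroup on T: nonempty finite multisets, since a
   semigroup has no empty sum. *)
Section FreeCommutativeSemigroup.
Variable T : choiceType.

Local Open Scope mset_scope.

Definition fcs : Type := {m : {mset T} | m != mset0}.
HB.instance Definition _ := Choice.on fcs.

Lemma seq_mset_neq0 (s : seq T) : (0 < size s)%N -> seq_mset s != mset0.
Proof.
apply: contraTneq => s0; rewrite -(perm_size (perm_eq_seq_mset s)) s0.
by rewrite enum_mset0.
Qed.

Lemma fcs_size (m : fcs) : (0 < size (val m))%N.
Proof.
case: m => m /= m0; rewrite lt0n size_eq0; apply: contra m0 => /eqP m0.
by rewrite -(seq_mset_id m) m0; apply/eqP/msetP => x; rewrite mset_seqE mset0E.
Qed.

Definition fcs_of (s : seq T) (s0 : (0 < size s)%N) : fcs :=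
  exist _ (seq_mset s) (seq_mset_neq0 s0).

Lemma fcs_add_subproof (m n : fcs) : (0 < size (val m ++ val n))%N.
Proof. by rewrite size_cat addn_gt0 fcs_size. Qed.

Definition fcs_add (m n : fcs) : fcs := fcs_of (fcs_add_subproof m n).

Definition fcs1 (x : T) : fcs := @fcs_of [:: x] isT.

Lemma fcs_ofE (s : seq T) (s0 : (0 < size s)%N) (V : nmodType) (f : T -> V) :
  \sum_(p <- val (fcs_of s0)) f p = \sum_(p <- s) f p.
Proof. exact/perm_big/perm_eq_seq_mset. Qed.

End FreeCommutativeSemigroup.

Section RightOperatorHemiring.
Variables (S G : nmodType) (M : gammaHemiring S G).

Let F := fcs (G * S)%type.

Definition fact (a : S) (m : F) : S := \sum_(p <- val m) M a p.1 p.2.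

Definition rho : rel F := fun m n => `[< forall a : S, fact a m = fact a n >].

Lemma rhoP m n : reflect (forall a, fact a m = fact a n) (rho m n).
Proof. exact: asboolP. Qed.

Lemma rho_refl : reflexive rho.
Proof. by move=> m; apply/rhoP. Qed.

Lemma rho_sym : symmetric rho.
Proof. by move=> m n; apply/rhoP/rhoP => mn a; rewrite mn. Qed.

Lemma rho_trans : transitive rho.
Proof. by move=> n m p /rhoP mn /rhoP np; apply/rhoP => a; rewrite mn. Qed.

Canonical rho_equiv := EquivRel rho rho_refl rho_sym rho_trans.

Definition right_op : Type := {eq_quot rho_equiv}.
HB.instance Definition _ := Choice.on right_op.
HB.instance Definition _ : EqQuotient F rho right_op :=
  EqQuotient.on right_op.

Implicit Types (r t u : right_op) (m n : F).

(* The element s alpha_1 x_1 + ... + s alpha_n x_n of S, for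
   r = [alpha_1, x_1] + ... + [alpha_n, x_n]. *)
Definition ract (s : S) r : S := fact s (repr r).

Lemma ract_pi s m : ract s (\pi_right_op m) = fact s m.
Proof.
rewrite /ract; case: piP => n /eqP.
by rewrite eqmodE => /rhoP.
Qed.

Lemma ract_inj r t : (forall s, ract s r = ract s t) -> r = t.
Proof.
move=> rt; rewrite -[r]reprK -[t]reprK; apply/eqP; rewrite eqmodE.
by apply/rhoP => a; exact: rt.
Qed.

Definition rop_class (x : G) (a : S) : right_op := \pi_right_op (fcs1 (x, a)).
Definition rop_zero : right_op := rop_class 0 0.
Definition rop_add r t : right_op := \pi_right_op (fcs_add (repr r) (repr t)).

Lemma fcs_mul_subproof m n :
  (0 < size [seq (p.1, M p.2 q.1 q.2) | p <- val m, q <- val n])%N.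
Proof. by rewrite size_allpairs muln_gt0 !fcs_size. Qed.

Definition fcs_mul m n : F := fcs_of (fcs_mul_subproof m n).
Definition rop_mul r t : right_op := \pi_right_op (fcs_mul (repr r) (repr t)).

Lemma gmul_suml (I : Type) (s : seq I) (f : I -> S) x c :
  M (\sum_(i <- s) f i) x c = \sum_(i <- s) M (f i) x c.
Proof.
by elim: s => [|i s IH]; rewrite ?big_nil ?gmul0l // !big_cons gmulDl IH.
Qed.

Lemma fact_add s m n : fact s (fcs_add m n) = fact s m + fact s n.
Proof. by rewrite /fact fcs_ofE big_cat. Qed.

Lemma fact_mul s m n : fact s (fcs_mul m n) = fact (fact s m) n.
Proof.
rewrite /fact fcs_ofE big_allpairs_dep exchange_big; apply: eq_bigr => q _ /=.
by rewrite gmul_suml; apply: eq_bigr => p _; rewrite gmulA.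
Qed.

Lemma fact1 s x a : fact s (fcs1 (x, a)) = M s x a.
Proof. by rewrite /fact fcs_ofE big_seq1. Qed.

Lemma ract_class s x a : ract s (rop_class x a) = M s x a.
Proof. by rewrite ract_pi fact1. Qed.

Lemma ract0 s : ract s rop_zero = 0.
Proof. by rewrite ract_class gmul0r. Qed.

Lemma ractD s r t : ract s (rop_add r t) = ract s r + ract s t.
Proof. by rewrite ract_pi fact_add. Qed.

Lemma ractM s r t : ract s (rop_mul r t) = ract (ract s r) t.
Proof. by rewrite ract_pi fact_mul. Qed.

Lemma ractDl s1 s2 r : ract (s1 + s2) r = ract s1 r + ract s2 r.
Proof.
by rewrite /ract /fact -big_split; apply: eq_bigr => p _; rewrite gmulDl.
Qed.

Lemma ract0l r : ract 0 r = 0.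
Proof. by rewrite /ract /fact big1 // => p _; rewrite gmul0l. Qed.

Lemma rop_addE m n : rop_add (\pi_right_op m) (\pi_right_op n) = \pi_right_op (fcs_add m n).
Proof. by apply: ract_inj => s; rewrite ractD !ract_pi fact_add. Qed.

Lemma rop_mulE m n : rop_mul (\pi_right_op m) (\pi_right_op n) = \pi_right_op (fcs_mul m n).
Proof. by apply: ract_inj => s; rewrite ractM !ract_pi fact_mul. Qed.

Lemma rop_zeroE x : rop_class x 0 = rop_zero.
Proof. by apply: ract_inj => s; rewrite ract0 ract_class gmul0r. Qed.

Lemma rop_addA : associative rop_add.
Proof. by move=> r t u; apply: ract_inj => s; rewrite !ractD addrA. Qed.

Lemma rop_addC : commutative rop_add.
Proof. by move=> r t; apply: ract_inj => s; rewrite !ractD addrC. Qed.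

Lemma rop_add0 : left_id rop_zero rop_add.
Proof. by move=> r; apply: ract_inj => s; rewrite ractD ract0 add0r. Qed.

HB.instance Definition _ :=
  GRing.isNmodule.Build right_op rop_addA rop_addC rop_add0.

Lemma rop_mulA r t u : rop_mul r (rop_mul t u) = rop_mul (rop_mul r t) u.
Proof. by apply: ract_inj => s; rewrite !ractM. Qed.

Lemma rop_mulDl r t u : rop_mul (r + t) u = rop_mul r u + rop_mul t u.
Proof. by apply: ract_inj => s; rewrite ractM !ractD !ractM ractDl. Qed.

Lemma rop_mulDr r t u : rop_mul r (t + u) = rop_mul r t + rop_mul r u.
Proof. by apply: ract_inj => s; rewrite ractM !ractD !ractM. Qed.

Lemma rop_mul0l r : rop_mul 0 r = 0.
Proof. by apply: ract_inj => s; rewrite ractM !ract0 ract0l. Qed.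

Lemma rop_mul0r r : rop_mul r 0 = 0.
Proof. by apply: ract_inj => s; rewrite ractM !ract0. Qed.

Definition right_op_hemiring : hemiring right_op :=
  Hemiring rop_mulA rop_mulDl rop_mulDr rop_mul0l rop_mul0r.

End RightOperatorHemiring.

Section FuzzySubsets.
Variables (K : realType) (X : Type).
Implicit Types mu sigma : X -> K.

Definition is_fuzzy mu : Prop := forall x, 0 <= mu x <= 1.

Definition nonempty_fuzzy mu : Prop := is_fuzzy mu /\ exists x, mu x != 0.

Definition fuzzy_sub mu sigma : Prop := forall x, mu x <= sigma x.

Definition nonconstant mu : Prop := exists x y, mu x != mu y.

Definition cartesian mu sigma : X * X -> K :=
  fun p => Num.min (mu p.1) (sigma p.2).

Definition cartesian_products (P : set (X -> K)) : set (X * X -> K) :=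
  [set cartesian mu sigma | mu in P & sigma in P].

End FuzzySubsets.

(* The ideal notions are stated once for a family of products
   op : X -> I -> X -> X: a Gamma-hemiring is the case I = Gamma, and a hemiring
   is the case of a single product, I = unit (see [hemiring_op]). *)
Section FuzzyIdeals.
Variables (K : realType) (X : nmodType) (I : Type) (op : X -> I -> X -> X).
Implicit Types mu nu zeta theta : X -> K.

Definition fuzzy_left_ideal mu : Prop :=
  [/\ nonempty_fuzzy mu,
      forall x y, Num.min (mu x) (mu y) <= mu (x + y)
    & forall x i y, mu y <= mu (op x i y)].

Definition fuzzy_right_ideal mu : Prop :=
  [/\ nonempty_fuzzy mu,
      forall x y, Num.min (mu x) (mu y) <= mu (x + y)
    & forall x i y, mu x <= mu (op x i y)].

Definition h_condition mu : Prop :=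
  forall a b x z, x + a + z = b + z -> Num.min (mu a) (mu b) <= mu x.

(* [mu 0 = 1] is the standing normalization of fuzzy h-ideals. *)
Definition fuzzy_left_h_ideal mu : Prop :=
  [/\ fuzzy_left_ideal mu, h_condition mu & mu 0 = 1].

Definition fuzzy_right_h_ideal mu : Prop :=
  [/\ fuzzy_right_ideal mu, h_condition mu & mu 0 = 1].

Definition fuzzy_h_ideal mu : Prop :=
  fuzzy_left_h_ideal mu /\ fuzzy_right_h_ideal mu.

(* When x has no expression the set is empty, and [sup set0 = 0]. *)
Definition h_product mu theta : X -> K := fun x =>
  sup [set v : K | exists a b c d z i j,
         x + op a i b + z = op c j d + z /\
         v = Num.min (Num.min (mu a) (mu c)) (Num.min (theta b) (theta d))].

Definition prime_fuzzy_h_ideal zeta : Prop :=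
  [/\ fuzzy_h_ideal zeta, nonconstant zeta
    & forall mu nu, fuzzy_h_ideal mu -> fuzzy_h_ideal nu ->
        fuzzy_sub (h_product mu nu) zeta ->
        fuzzy_sub mu zeta \/ fuzzy_sub nu zeta].

Definition semiprime_fuzzy_h_ideal zeta : Prop :=
  [/\ fuzzy_h_ideal zeta, nonconstant zeta
    & forall mu, fuzzy_h_ideal mu ->
        fuzzy_sub (h_product mu mu) zeta -> fuzzy_sub mu zeta].

End FuzzyIdeals.

Arguments fuzzy_h_ideal {K X I} op mu.
Arguments prime_fuzzy_h_ideal {K X I} op zeta.
Arguments semiprime_fuzzy_h_ideal {K X I} op zeta.

Definition hemiring_op (H : nmodType) (N : hemiring H) : H -> unit -> H -> H :=
  fun x _ y => N x y.

Definition right_op_op (S G : nmodType) (M : gammaHemiring S G) :=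
  hemiring_op (right_op_hemiring M).

Arguments right_op_op {S G} M.

(* The map sigma |-> sigma^{*'}. *)
Definition star' (K : realType) (S G : nmodType) (M : gammaHemiring S G)
    (sigma : S -> K) : right_op M -> K :=
  fun r => inf [set sigma (ract s r) | s in [set: S]].

Arguments star' {K S G} M sigma.

(* mu x sigma |-> mu^{*'} x sigma^{*'} is a well-defined inclusion preserving
   bijection from the products of members of P onto the products of members
   of Q. *)
Definition star'_bijection (K : realType) (S G : nmodType)
    (M : gammaHemiring S G)
    (P : set (S -> K)) (Q : set (right_op M -> K)) : Prop :=
  exists Phi : (S * S -> K) -> (right_op M * right_op M -> K),
    [/\ forall mu sigma, P mu -> P sigma ->
          Phi (cartesian mu sigma)
            = cartesian (star' M mu) (star' M sigma),
        set_bij (cartesian_products P) (cartesian_products Q) Phi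
      & forall p q, cartesian_products P p -> cartesian_products P q ->
          fuzzy_sub p q -> fuzzy_sub (Phi p) (Phi q)].

Arguments star'_bijection {K S G} M P Q.

(* Main.v *)
Require Import Defs.
From mathcomp Require Import all_boot all_order all_algebra.
From mathcomp Require Import boolp classical_sets functions reals.

(* The inverse of [star'] is [mu |-> (x |-> inf_gamma mu [gamma, x])]: by the
   unities every [x] is a sum of elements [s gamma x], and every [r] a sum of
   elements [[gamma, f] r].  A product of h-ideals lies below an h-ideal [zeta]
   iff [min (mu a) (nu b) <= zeta (a b)] for all [a], [b], and this condition
   is transported by [star'].  Finally a cartesian product determines its
   factors, [(mu x sigma) (x, 0) = mu x], because ideals take the value 1 at 0. *)

Set Implicit Arguments.
Unset Strict Implicit.
Unset Printing Implicit Defensive.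

Import Order.TTheory GRing.Theory Num.Theory.

Local Open Scope classical_set_scope.
Local Open Scope ring_scope.

(** * Infima of real-valued families *)

Section Infima.
Variables (K : realType) (I : Type) (f : I -> K).

(** The index [i0] keeps the image non-empty: the infimum of the empty set is the default [0], which
    may lie below [c]. *)
Lemma le_inf_image (i0 : I) (c : K) :
  (forall i, c <= f i) -> c <= inf [set f i | i in [set: I]].
Proof.
move=> cf; apply: lb_le_inf; first by exists (f i0); exists i0.
by move=> _ [i _ <-].
Qed.

Lemma inf_image_le (i : I) :
  (forall i, 0 <= f i) -> inf [set f i | i in [set: I]] <= f i.
Proof.
move=> f0; apply: ge_inf; last by exists i.
by exists 0 => _ [j _ <-].
Qed.

End Infima.

(** * Elementary properties of fuzzy h-ideals *)

Section FuzzyHIdeals.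
Variables (K : realType) (X : nmodType) (I : Type) (op : X -> I -> X -> X).
Implicit Types mu nu zeta : X -> K.

(** The left and right notions share all clauses but one, and non-emptiness comes from the value [1]
    at [0]. *)
Lemma fuzzy_h_idealP mu : fuzzy_h_ideal op mu <->
  [/\ is_fuzzy mu /\ mu 0 = 1,
      forall x y, Num.min (mu x) (mu y) <= mu (x + y),
      forall x i y, mu y <= mu (op x i y),
      forall x i y, mu x <= mu (op x i y)
    & h_condition mu].
Proof.
split=> [[[[[fmu _] D l] h mu0] [[_ _ r] _ _]]|[[fmu mu0] D l r h]].
  by split.
have ne : nonempty_fuzzy mu by split=> //; exists 0; rewrite mu0 oner_neq0.
by split; split.
Qed.

Variable mu : X -> K.
Hypothesis mu_ideal : fuzzy_h_ideal op mu.

Lemma ideal_ge0 x : 0 <= mu x.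
Proof. by have [[f _] _ _ _ _] := (fuzzy_h_idealP mu).1 mu_ideal; case/andP: (f x). Qed.

Lemma ideal_le1 x : mu x <= 1.
Proof. by have [[f _] _ _ _ _] := (fuzzy_h_idealP mu).1 mu_ideal; case/andP: (f x). Qed.

Lemma ideal0 : mu 0 = 1.
Proof. by have [[]] := (fuzzy_h_idealP mu).1 mu_ideal. Qed.

Lemma ideal_add x y : Num.min (mu x) (mu y) <= mu (x + y).
Proof. by have [_ D _ _ _] := (fuzzy_h_idealP mu).1 mu_ideal. Qed.

Lemma ideal_mull x i y : mu y <= mu (op x i y).
Proof. by have [_ _ l _ _] := (fuzzy_h_idealP mu).1 mu_ideal. Qed.

Lemma ideal_mulr x i y : mu x <= mu (op x i y).
Proof. by have [_ _ _ r _] := (fuzzy_h_idealP mu).1 mu_ideal. Qed.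

Lemma ideal_h : h_condition mu.
Proof. by have [_ _ _ _ h] := (fuzzy_h_idealP mu).1 mu_ideal. Qed.

(** The bound [c <= 1] covers the empty sum, where [mu 0 = 1]. *)
Lemma ideal_sum (T : Type) (s : seq T) (f : T -> X) (c : K) :
  c <= 1 -> (forall t, c <= mu (f t)) -> c <= mu (\sum_(t <- s) f t).
Proof.
move=> c1 cf; apply: (big_ind (fun x => c <= mu x)); first by rewrite ideal0.
  by move=> x y cx cy; apply: le_trans (ideal_add x y); rewrite le_min cx.
by move=> t _.
Qed.

(** Since [mu 0 = 1], the only possible constant value is [1]. *)
Lemma nonconstantP : nonconstant mu <-> ~ forall x, mu x = 1.
Proof.
split=> [[x [y xy]] mu1|nmu1]; first by rewrite !mu1 eqxx in xy.
have /existsNP [x /eqP mux] := nmu1.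
by exists x, 0; rewrite ideal0.
Qed.

End FuzzyHIdeals.

(** * Recovering the factors of a cartesian product *)

Section Cartesian.
Variables (K : realType) (X : nmodType) (I : Type) (op : X -> I -> X -> X).

Lemma cartesian0r (mu sigma : X -> K) x :
  fuzzy_h_ideal op mu -> fuzzy_h_ideal op sigma ->
  cartesian mu sigma (x, 0) = mu x.
Proof. by move=> hmu hs; rewrite /cartesian /= (ideal0 hs) min_l ?(ideal_le1 hmu). Qed.

Lemma cartesian0l (mu sigma : X -> K) y :
  fuzzy_h_ideal op mu -> fuzzy_h_ideal op sigma ->
  cartesian mu sigma (0, y) = sigma y.
Proof. by move=> hmu hs; rewrite /cartesian /= (ideal0 hmu) min_r ?(ideal_le1 hs). Qed.

End Cartesian.

(** * Inclusions of simple h-products *)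

Section HProduct.
Variables (K : realType) (X : nmodType) (I : Type) (op : X -> I -> X -> X).
Hypothesis op0l : forall i x, op 0 i x = 0.

(** Single products suffice: the h-condition bounds [zeta x] below by the values of [zeta] at the
    two products of any expression of [x], and [op a i b] is itself expressible. *)
Lemma h_product_subP (mu nu zeta : X -> K) :
  fuzzy_h_ideal op mu -> fuzzy_h_ideal op nu -> fuzzy_h_ideal op zeta ->
  fuzzy_sub (h_product op mu nu) zeta <->
  forall a i b, Num.min (mu a) (nu b) <= zeta (op a i b).
Proof.
move=> hmu hnu hzeta; split=> [sub a i b|le x].
  apply: le_trans (sub (op a i b)); apply: ub_le_sup.
    by exists 1 => _ [? [? [? [? [? [? [? [_ ->]]]]]]]]; rewrite !ge_min (ideal_le1 hmu).
  (* The expression is [ab + 00 + 0 = ab + 0]; its zero factors have value [1] and drop out of the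
     minimum. *)
  exists 0, 0, a, b, 0, i, i; rewrite op0l addr0; split=> //.
  by rewrite (ideal0 hmu) (ideal0 hnu) (min_r (ideal_le1 hmu a)) (min_r (ideal_le1 hnu b)).
rewrite /h_product; set A := [set v | _].
(* Without any expression of [x] the supremum takes its default value [0]. *)
have [->|/set0P A0] := eqVneq A set0; first by rewrite sup0 (ideal_ge0 hzeta).
apply: ge_sup => // _ [a [b [c [d [z [i [j [e ->]]]]]]]].
apply: le_trans (ideal_h hzeta e).
by rewrite minACA; apply: le_min2.
Qed.

End HProduct.

(** * The right action of the operator hemiring on [S] *)

Section RightOperatorAction.
Variables (S G : nmodType) (M : gammaHemiring S G).

Lemma gmul_sumr (I : Type) (s : seq I) (f : I -> S) a x :
  M a x (\sum_(i <- s) f i) = \sum_(i <- s) M a x (f i).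
Proof. by apply: (big_morph _ (gmulDr M a x) (gmul0r M a x)). Qed.

Lemma ract_gmul a x b (r : right_op M) :
  ract (M a x b) r = M a x (ract b r).
Proof. by rewrite /ract /fact gmul_sumr; apply: eq_bigr => q _; rewrite gmulA. Qed.

Lemma ract_suml (I : Type) (s : seq I) (f : I -> S) (r : right_op M) :
  ract (\sum_(i <- s) f i) r = \sum_(i <- s) ract (f i) r.
Proof.
by elim/big_rec2: _ => [|i a b _ <-]; rewrite ?ract0l ?ractDl.
Qed.

Lemma ract_sumr (I : Type) (s : seq I) (f : I -> right_op M) a :
  ract a (\sum_(i <- s) f i) = \sum_(i <- s) ract a (f i).
Proof.
by elim/big_rec2: _ => [|i r t _ <-]; [exact: ract0 | exact: ractD].
Qed.

Lemma rop_classD x a b :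
  rop_class M x (a + b) = rop_class M x a + rop_class M x b.
Proof. by apply: ract_inj => s; rewrite ractD !ract_class gmulDr. Qed.

Lemma rop_class_ract x a r : rop_class M x (ract a r) = rop_mul (rop_class M x a) r.
Proof. by apply: ract_inj => s; rewrite ractM !ract_class ract_gmul. Qed.

Lemma rop_class_gmul x a y b :
  rop_class M x (M a y b) = rop_mul (rop_class M x a) (rop_class M y b).
Proof. by rewrite -rop_class_ract ract_class. Qed.

(** Expanding [a] by the right unity turns the action of [r] into products in [S] with left factor
    [a]; this exposes [s r t] to the product bounds on [S]. *)
Lemma ract_unity gf a (r : right_op M) : (forall b, \sum_(p <- gf) M b p.1 p.2 = b) ->
  ract a r = \sum_(p <- gf) M a p.1 (ract p.2 r).
Proof.
by move=> gf1; rewrite -{1}[a]gf1 ract_suml; apply: eq_bigr => p _; rewrite ract_gmul.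
Qed.

(** The sum of the classes of the right unity acts on [S] as the identity, so it is a left identity
    of the operator hemiring. *)
Lemma rop_unity gf (r : right_op M) : (forall b, \sum_(p <- gf) M b p.1 p.2 = b) ->
  r = \sum_(p <- gf) rop_mul (rop_class M p.1 p.2) r.
Proof.
move=> gf1; apply: ract_inj => s; rewrite ract_sumr -{1}[s]gf1 ract_suml.
by apply: eq_bigr => p _; rewrite ractM ract_class.
Qed.

End RightOperatorAction.

(** * The maps [star'] and [star] are mutually inverse on h-ideals *)

Section Star.
Variables (K : realType) (S G : nmodType) (M : gammaHemiring S G).

Definition star (mu : right_op M -> K) : S -> K :=
  fun x => inf [set mu (rop_class M g x) | g in [set: G]].

Lemma star'_mono (mu nu : S -> K) :
  (forall x, 0 <= mu x) -> fuzzy_sub mu nu -> fuzzy_sub (star' M mu) (star' M nu).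
Proof.
move=> mu0 munu r; apply: (le_inf_image 0) => s.
by apply: le_trans (munu _); apply: (inf_image_le (f := fun s => mu (ract s r))).
Qed.

Lemma star_mono (mu nu : right_op M -> K) :
  (forall x, 0 <= mu x) -> fuzzy_sub mu nu -> fuzzy_sub (star mu) (star nu).
Proof.
move=> mu0 munu x; apply: (le_inf_image 0) => g.
by apply: le_trans (munu _); apply: (inf_image_le (f := fun g => mu (rop_class M g x))).
Qed.

Lemma star'_ideal (mu : S -> K) :
  fuzzy_h_ideal (gmul M) mu -> fuzzy_h_ideal (right_op_op M) (star' M mu).
Proof.
move=> hmu.
have le s r : star' M mu r <= mu (ract s r).
  by apply: (inf_image_le (f := fun s => mu (ract s r))) => i; apply: (ideal_ge0 hmu).
apply/fuzzy_h_idealP; split.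
- split=> [r|]; first apply/andP; first split.
  + by apply: (le_inf_image 0) => s; apply: (ideal_ge0 hmu).
  + exact: le_trans (le 0 r) (ideal_le1 hmu _).
  + apply/le_anti/andP; split; first exact: le_trans (le 0 0) (ideal_le1 hmu _).
    by apply: (le_inf_image 0) => s; rewrite ract0 (ideal0 hmu).
- move=> r t; apply: (le_inf_image 0) => s.
  by rewrite ractD; apply: le_trans (ideal_add hmu _ _); apply: le_min2.
(* As [s (t r) = (s t) r], the value is already in the family whose infimum is [star' M mu r]. *)
- by move=> t i r; apply: (le_inf_image 0) => s; rewrite ractM.
(* Here [(s r) t] unfolds to a sum of products with left factor [s r], each bounded by the right
   ideal property. *)
- move=> r i t; apply: (le_inf_image 0) => s; rewrite ractM.
  apply: (ideal_sum hmu) => [|p]; first exact: le_trans (le s r) (ideal_le1 hmu _).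
  exact: le_trans (le s r) (ideal_mulr hmu _ _ _).
- move=> a b r z e; apply: (le_inf_image 0) => s.
  have e' : ract s r + ract s a + ract s z = ract s b + ract s z.
    by rewrite -!ractD; congr ract.
  by apply: le_trans (ideal_h hmu e'); apply: le_min2.
Qed.

Lemma star_ideal (mu : right_op M -> K) :
  fuzzy_h_ideal (right_op_op M) mu -> fuzzy_h_ideal (gmul M) (star mu).
Proof.
move=> hmu.
have le g x : star mu x <= mu (rop_class M g x).
  by apply: (inf_image_le (f := fun g => mu (rop_class M g x))) => i; apply: (ideal_ge0 hmu).
apply/fuzzy_h_idealP; split.
- split=> [x|]; first apply/andP; first split.
  + by apply: (le_inf_image 0) => g; apply: (ideal_ge0 hmu).
  + exact: le_trans (le 0 x) (ideal_le1 hmu _).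
  + apply/le_anti/andP; split; first exact: le_trans (le 0 0) (ideal_le1 hmu _).
    by apply: (le_inf_image 0) => g; rewrite rop_zeroE (ideal0 hmu).
- move=> x y; apply: (le_inf_image 0) => g.
  by rewrite rop_classD; apply: le_trans (ideal_add hmu _ _); apply: le_min2.
- move=> x b y; apply: (le_inf_image 0) => g; rewrite rop_class_gmul.
  exact: le_trans (le b y) (ideal_mull hmu _ tt _).
- move=> x b y; apply: (le_inf_image 0) => g; rewrite rop_class_gmul.
  exact: le_trans (le g x) (ideal_mulr hmu _ tt _).
- move=> a b x z e; apply: (le_inf_image 0) => g.
  have e' : rop_class M g x + rop_class M g a + rop_class M g z =
            rop_class M g b + rop_class M g z by rewrite -!rop_classD e.
  by apply: le_trans (ideal_h hmu e'); apply: le_min2.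
Qed.

(** The double infimum runs over the values [mu (s g x)]. Each is at least [mu x] by the left ideal
    property, and the left unity writes [x] as a sum of such elements [s g x]. *)
Lemma star'K (mu : S -> K) : has_left_unity M ->
  fuzzy_h_ideal (gmul M) mu -> star (star' M mu) = mu.
Proof.
move=> [ed ed1] hmu; have hmu' := star'_ideal hmu; apply: funext => x.
apply/le_anti/andP; split.
  rewrite -{2}[x]ed1; apply: (ideal_sum hmu) => [|p].
    exact: ideal_le1 (star_ideal hmu') _.
  apply: le_trans (inf_image_le (f := fun g => star' M mu (rop_class M g x)) p.2 _) _.
    by move=> g; apply: (ideal_ge0 hmu').
  rewrite -ract_class; apply: (inf_image_le (f := fun s => mu (ract s _))) => s.
  exact: (ideal_ge0 hmu).
apply: (le_inf_image 0) => g; apply: (le_inf_image 0) => s.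
by rewrite ract_class; apply: (ideal_mull hmu).
Qed.

(** Dually, the double infimum runs over [mu ([g, s] r)], and the right unity writes [r] as a sum of
    elements [[g, s] r]. *)
Lemma starK (mu : right_op M -> K) : has_right_unity M ->
  fuzzy_h_ideal (right_op_op M) mu -> star' M (star mu) = mu.
Proof.
move=> [gf gf1] hmu; have hmu' := star_ideal hmu; apply: funext => r.
apply/le_anti/andP; split.
  rewrite [in leRHS](rop_unity r gf1); apply: (ideal_sum hmu) => [|p].
    exact: ideal_le1 (star'_ideal hmu') _.
  apply: le_trans (inf_image_le (f := fun s => star mu (ract s r)) p.2 _) _.
    by move=> s; apply: (ideal_ge0 hmu').
  rewrite -rop_class_ract; apply: (inf_image_le (f := fun g => mu (rop_class M g _))) => g.
  exact: (ideal_ge0 hmu).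
apply: (le_inf_image 0) => s; apply: (le_inf_image 0) => g.
by rewrite rop_class_ract; apply: (ideal_mull hmu _ tt).
Qed.

(** * Transport of inclusion, primeness and semiprimeness *)

Hypotheses (left_unity : has_left_unity M) (right_unity : has_right_unity M).

Lemma star'_sub (mu nu : S -> K) :
  fuzzy_h_ideal (gmul M) mu -> fuzzy_h_ideal (gmul M) nu ->
  fuzzy_sub (star' M mu) (star' M nu) <-> fuzzy_sub mu nu.
Proof.
move=> hmu hnu; split=> [sub|]; last exact/star'_mono/(ideal_ge0 hmu).
rewrite -(star'K left_unity hmu) -(star'K left_unity hnu).
exact/star_mono/sub/(ideal_ge0 (star'_ideal hmu)).
Qed.

Lemma star'_nonconstant (mu : S -> K) : fuzzy_h_ideal (gmul M) mu ->
  nonconstant (star' M mu) <-> nonconstant mu.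
Proof.
move=> hmu; have hmu' := star'_ideal hmu.
rewrite (nonconstantP hmu) (nonconstantP hmu').
split; apply: contra_not => mu1 x; apply/le_anti.
- rewrite (ideal_le1 hmu') /=.
  by apply: (le_inf_image 0) => s; rewrite mu1.
- rewrite (ideal_le1 hmu) /= -(star'K left_unity hmu).
  by apply: (le_inf_image 0) => g; rewrite mu1.
Qed.

Lemma star'_h_product (mu nu zeta : S -> K) :
  fuzzy_h_ideal (gmul M) mu -> fuzzy_h_ideal (gmul M) nu ->
  fuzzy_h_ideal (gmul M) zeta ->
  fuzzy_sub (h_product (right_op_op M) (star' M mu) (star' M nu)) (star' M zeta)
  <-> fuzzy_sub (h_product (gmul M) mu nu) zeta.
Proof.
move=> hmu hnu hz.
have hmu' := star'_ideal hmu; have hnu' := star'_ideal hnu.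
have hz' := star'_ideal hz.
have op0l (i : unit) (x : right_op M) : right_op_op M 0 i x = 0.
  exact: rop_mul0l.
apply: (iff_trans (h_product_subP op0l hmu' hnu' hz')).
apply: iff_trans (iff_sym (h_product_subP (gmul0l M) hmu hnu hz)).
split=> le.
  (* Test the hypothesis on [[g', a]] and [[g, b]]: by the left ideal property, [star'] takes there
     at least the values [mu a] and [nu b]. *)
  move=> a g b; rewrite -(star'K left_unity hz).
  apply: (le_inf_image 0) => g'; rewrite rop_class_gmul.
  apply: le_trans (le (rop_class M g' a) tt (rop_class M g b)).
  apply: le_min2; apply: (le_inf_image 0) => s; rewrite ract_class.
    exact: (ideal_mull hmu).
  exact: (ideal_mull hnu).
move=> r i t; apply: (le_inf_image 0) => s; rewrite ractM.
(* By the right unity, [s r t] is a sum of products of [s r] with elements [f t], at which [mu] and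
   [nu] are at least [star' M mu r] and [star' M nu t]. *)
have [gf gf1] := right_unity.
rewrite (ract_unity _ _ gf1); apply: (ideal_sum hz) => [|p].
  by rewrite ge_min (ideal_le1 hmu').
apply: le_trans (le _ _ _); apply: le_min2.
  apply: (inf_image_le (f := fun s => mu (ract s r))) => ?.
  exact: (ideal_ge0 hmu).
apply: (inf_image_le (f := fun s => nu (ract s t))) => ?.
exact: (ideal_ge0 hnu).
Qed.

(** Primeness tests against all h-ideals, and by [starK] every h-ideal of the operator hemiring is a
    [star'] image; both inclusions in the test transfer along [star']. *)
Lemma star'_prime (zeta : S -> K) : fuzzy_h_ideal (gmul M) zeta ->
  prime_fuzzy_h_ideal (right_op_op M) (star' M zeta) <->
  prime_fuzzy_h_ideal (gmul M) zeta.
Proof.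
move=> hz; split=> -[_ nc pr]; split=> //.
- exact/star'_nonconstant.
- move=> mu nu hmu hnu /star'_h_product sub.
  have [//|//|||] := pr _ _ (star'_ideal hmu) (star'_ideal hnu) (sub _ _ _) => //.
    by move/(star'_sub hmu hz); left.
  by move/(star'_sub hnu hz); right.
- exact: star'_ideal.
- exact/star'_nonconstant.
move=> mu nu /[dup] hmu /(starK right_unity) <- /[dup] hnu /(starK right_unity) <-.
have hmu' := star_ideal hmu; have hnu' := star_ideal hnu.
move/star'_h_product => sub.
rewrite !star'_sub //; exact: pr (sub _ _ _).
Qed.

Lemma star'_semiprime (zeta : S -> K) : fuzzy_h_ideal (gmul M) zeta ->
  semiprime_fuzzy_h_ideal (right_op_op M) (star' M zeta) <->
  semiprime_fuzzy_h_ideal (gmul M) zeta.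
Proof.
move=> hz; split=> -[_ nc pr]; split=> //.
- exact/star'_nonconstant.
- move=> mu hmu sub; apply/(star'_sub hmu hz)/pr; first exact: star'_ideal.
  exact/star'_h_product.
- exact: star'_ideal.
- exact/star'_nonconstant.
move=> mu /[dup] hmu /(starK right_unity) <-.
have hmu' := star_ideal hmu.
by move=> /(star'_h_product hmu' hmu' hz) sub; apply/star'_sub => //; apply: pr.
Qed.

(** * The bijection between cartesian products *)

Lemma star'_bijectionP (P : set (S -> K)) (Q : set (right_op M -> K)) :
  P `<=` fuzzy_h_ideal (gmul M) -> Q `<=` fuzzy_h_ideal (right_op_op M) ->
  (forall mu, fuzzy_h_ideal (gmul M) mu -> Q (star' M mu) <-> P mu) ->
  star'_bijection M P Q.
Proof.
move=> PI QI QP.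
(* Restricting to the two axes recovers the factors, so [Phi] is well defined without choosing a
   decomposition of [p]. *)
pose Phi (p : S * S -> K) :=
  cartesian (star' M (fun x => p (x, 0))) (star' M (fun y => p (0, y))).
have PhiE mu sigma : P mu -> P sigma ->
    Phi (cartesian mu sigma) = cartesian (star' M mu) (star' M sigma).
  move=> /PI hmu /PI hs; rewrite /Phi; congr (cartesian (star' M _) (star' M _)).
    by apply: funext => x; rewrite (cartesian0r _ hmu hs).
  by apply: funext => y; rewrite (cartesian0l _ hmu hs).
have QS mu : P mu -> Q (star' M mu) by move=> Pmu; apply/QP => //; apply: PI.
exists Phi; split=> //; first split.
- by move=> _ [mu Pmu [sigma Ps <-]]; rewrite /= PhiE //;
    exists (star' M mu); [exact: QS | exists (star' M sigma); first exact: QS].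
(* Injectivity: equal images agree on both axes, so the [star'] images of the factors coincide, and
   [star] cancels [star']. *)
- move=> p q /set_mem [mu Pmu [sigma Ps <-]] /set_mem [nu Pnu [tau Pt <-]].
  rewrite !PhiE // => e.
  have [hmu hs hnu ht] := And4 (PI _ Pmu) (PI _ Ps) (PI _ Pnu) (PI _ Pt).
  congr cartesian.
    rewrite -(star'K left_unity hmu) -(star'K left_unity hnu); congr star.
    apply: funext => r; move: (congr1 (@^~ (r, 0)) e) => /=.
    by rewrite !(cartesian0r (op := right_op_op M)) //; apply: star'_ideal.
  rewrite -(star'K left_unity hs) -(star'K left_unity ht); congr star.
  apply: funext => r; move: (congr1 (@^~ (0, r)) e) => /=.
  by rewrite !(cartesian0l (op := right_op_op M)) //; apply: star'_ideal.
(* Surjectivity: [star] supplies the preimages of the factors, which lie in [P] because [star']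
   returns them to [Q]. *)
- move=> _ [mu Qmu [sigma Qs <-]].
  have [hmu hs] := conj (QI _ Qmu) (QI _ Qs).
  have Pstar nu : Q nu -> P (star nu).
    move=> Qnu; have hnu := QI _ Qnu; apply/QP; first exact: star_ideal.
    by rewrite starK.
  exists (cartesian (star mu) (star sigma)).
    by exists (star mu); [exact: Pstar | exists (star sigma); first exact: Pstar].
  by rewrite PhiE ?starK //; exact: Pstar.
(* An inclusion of products restricts on the axes to inclusions of the factors, which [star']
   preserves. *)
move=> _ _ [mu Pmu [sigma Ps <-]] [nu Pnu [tau Pt <-]] sub [r t].
have [hmu hs hnu ht] := And4 (PI _ Pmu) (PI _ Ps) (PI _ Pnu) (PI _ Pt).
rewrite !PhiE //; apply: le_min2.
  apply: (star'_sub hmu hnu).2 => x.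
  by have := sub (x, 0); rewrite !(cartesian0r (op := gmul M)).
apply: (star'_sub hs ht).2 => x.
by have := sub (0, x); rewrite !(cartesian0l (op := gmul M)).
Qed.

End Star.

Theorem theorem4p12 (K : realType) (S G : nmodType) (M : gammaHemiring S G)
    (left_unity : has_left_unity M) (right_unity : has_right_unity M) :
  [/\ @star'_bijection K S G M
        (fuzzy_h_ideal (gmul M))
        (fuzzy_h_ideal (right_op_op M)),
      @star'_bijection K S G M
        (prime_fuzzy_h_ideal (gmul M))
        (prime_fuzzy_h_ideal (right_op_op M))
    & @star'_bijection K S G M
        (semiprime_fuzzy_h_ideal (gmul M))
        (semiprime_fuzzy_h_ideal (right_op_op M))].
Proof.
split; apply: star'_bijectionP => //.
- by move=> mu hmu; split=> // _; apply: star'_ideal.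
- by move=> mu [].
- by move=> mu [].
- by move=> mu; apply: star'_prime.
- by move=> mu [].
- by move=> mu [].
- by move=> mu; apply: star'_semiprime.
Qed.
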